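(* Let $t,k,\gamma\in\mathbb{R}$ and let $w(x;t)=|x-k|^{\gamma}\exp\{-v(x;t)\}$ for $x\in\mathbb{R}$, where $x\mapsto v(x;t)$ is a continuously differentiable function on $\mathbb{R}$. Let $\{P_n(x;t)\}_{n=0}^{\infty}$ be the monic polynomials in $x$, $\deg P_n=n$, satisfying $$\int_{-\infty}^{\infty}P_n(x;t)P_m(x;t)\,w(x;t)\,dx=h_n\delta_{mn},\qquad h_n>0 .$$ Then, for $\gamma\ge 1$ and every $n\ge 1$, $P_n(x;t)$ satisfies the differential-difference equation $$(x-k)\frac{dP_n}{dx}(x;t)=-B_n(x;t)P_n(x;t)+A_n(x;t)P_{n-1}(x;t),$$ where $$A_n(x;t)=\frac{x-k}{h_{n-1}}\int_{-\infty}^{\infty}P_n^2(y;t)\,\mathcal{K}(x,y)\,w(y;t)\,dy+a_n(x;t),$$ $$B_n(x;t)=\frac{x-k}{h_{n-1}}\int_{-\infty}^{\infty}P_n(y;t)P_{n-1}(y;t)\,\mathcal{K}(x,y)\,w(y;t)\,dy+b_n(x;t),$$ with $$\mathcal{K}(x,y)=\frac{v'(x;t)-v'(y;t)}{x-y},$$ $$a_n(x;t)=\frac{\gamma}{h_{n-1}}\int_{-\infty}^{\infty}\frac{P_n^2(y;t)}{y-k}\,w(y;t)\,dy,\qquad b_n(x;t)=\frac{\gamma}{h_{n-1}}\int_{-\infty}^{\infty}\frac{P_n(y;t)P_{n-1}(y;t)}{y-k}\,w(y;t)\,dy.$$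
   Context: A prime on $v$ denotes the derivative with respect to the first variable: $v'(x;t)=\frac{dv}{dx}(x;t)$; $t$ is a fixed real parameter. Standing assumptions: all moments $\int_{\mathbb{R}}x^n w(x;t)\,dx$, $n\ge0$, exist, and the integrals defining $A_n$ and $B_n$ converge. *)

(* Defs.v *)
From HB Require Import structures.
From mathcomp Require Import all_boot all_order all_algebra.
From mathcomp Require Import all_classical all_reals all_analysis.

Set Implicit Arguments.
Unset Strict Implicit.
Unset Printing Implicit Defensive.

Import Order.TTheory GRing.Theory Num.Theory.
Import numFieldNormedType.Exports.

Local Open Scope classical_set_scope.
Local Open Scope ring_scope.

(* Integrals over the real line are Lebesgue integrals. [Rintegral] returns a
   default value on non-integrable functions, so convergence is always a
   separate hypothesis, expressed with [integrableR]. *)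
Definition integrableR (R : realType) (f : R -> R) : Prop :=
  (@lebesgue_measure R).-integrable setT (EFin \o f).

Definition integralR (R : realType) (f : R -> R) : R :=
  \int[@lebesgue_measure R]_(y in setT) f y.

Definition weight (R : realType) (k gamma : R) (v : R -> R -> R) (x t : R) : R :=
  `|x - k| `^ gamma * expR (- v x t).

Definition dv (R : realType) (v : R -> R -> R) (x t : R) : R :=
  derive1 (v ^~ t) x.

Definition monic_orthogonal (R : realType) (w : R -> R)
    (p : nat -> {poly R}) (h : nat -> R) : Prop :=
  [/\ forall n, p n \is monic /\ size (p n) = n.+1,
      forall m n,
        integralR (fun x => (p n).[x] * (p m).[x] * w x) = h n * (m == n)%:R
    & forall n, 0 < h n].

(* On the diagonal x = y this is 0 (division by 0); in the integrals below the
   diagonal is a single point y, hence negligible. The same remark applies to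
   the factor 1 / (y - k) at y = k. *)
Definition kernelK (R : realType) (v : R -> R -> R) (t x y : R) : R :=
  (dv v x t - dv v y t) / (x - y).

Section LadderIntegrands.
Variables (R : realType) (k gamma : R) (v : R -> R -> R).
Variables (P : nat -> R -> {poly R}) (n : nat) (t : R).

Definition A_integrand (x y : R) : R :=
  (P n t).[y] ^+ 2 * kernelK v t x y * weight k gamma v y t.

Definition B_integrand (x y : R) : R :=
  (P n t).[y] * (P n.-1 t).[y] * kernelK v t x y * weight k gamma v y t.

Definition a_integrand (y : R) : R :=
  (P n t).[y] ^+ 2 / (y - k) * weight k gamma v y t.

Definition b_integrand (y : R) : R :=
  (P n t).[y] * (P n.-1 t).[y] / (y - k) * weight k gamma v y t.

End LadderIntegrands.

Section LadderCoefficients.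
Variables (R : realType) (k gamma : R) (v : R -> R -> R).
Variables (P : nat -> R -> {poly R}) (h : nat -> R -> R) (n : nat) (t : R).

Definition a_coef : R :=
  gamma / h n.-1 t * integralR (a_integrand k gamma v P n t).

Definition b_coef : R :=
  gamma / h n.-1 t * integralR (b_integrand k gamma v P n t).

Definition A_coef (x : R) : R :=
  (x - k) / h n.-1 t * integralR (A_integrand k gamma v P n t x) + a_coef.

Definition B_coef (x : R) : R :=
  (x - k) / h n.-1 t * integralR (B_integrand k gamma v P n t x) + b_coef.

End LadderCoefficients.

(* Main.v *)
From HB Require Import structures.
Require Import Defs.
From mathcomp Require Import all_boot all_order all_algebra.
From mathcomp Require Import all_classical all_reals all_analysis.
From mathcomp Require Import measurable_realfun ring lra.

(** Fix t, drop it from the notation, and write n = m + 1, L f for the integral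
    of f w, and S for the Christoffel-Darboux kernel, the polynomial of degree
    at most m in y with

      S(y) (y - x) = P_m(x) P_n(y) - P_n(x) P_m(y).

    Two facts about S are purely algebraic ([cd_kernel_reproduces],
    [cd_kernel_deriv]): L (f S) = h_m f(x) whenever deg f <= m, and P_n is
    orthogonal to S and to S'. Hence L ((P_n S)') = h_m P_n'(x), and the theorem
    is what remains after integrating the left-hand side by parts
    ([moment_deriv]):

      L ((P_n S)') = int P_n S (v' - gamma / (y - k)) w dy.

    The right-hand side is recognised in the combination P_m(x) A_n - P_n(x) B_n,
    whose integrands all carry the factor S(y) (y - x). In the integrals with the
    kernel K that factor cancels the denominator of K and leaves
    P_n S (v'(y) - v'(x)) w, where the v'(x) part integrates to 0. In a_n and b_n
    it produces (y - x) / (y - k) = 1 - (x - k) / (y - k), where the 1 integrates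
    to 0. If x = k the integrals with K drop out, and a_n and b_n combine to
    L (P_n S) = 0, so that both sides vanish.

    The boundary terms of the integration by parts disappear without any
    knowledge of the growth of v. For x different from k, the same two identities
    turn the assumed convergence of the integrals in A_n and B_n into
    integrability of P_n S v' w and of P_n S w / (y - k), so that both
    G = P_n S w and G' are integrable. An integrable G is arbitrarily small at
    suitable points near both infinities, and integrating G' between such points
    gives 0 in the limit ([integral_derive_eq0]). The weight is not differentiable
    at k when gamma = 1, but it is continuous there, which is enough. *)

Set Implicit Arguments.
Unset Strict Implicit.
Unset Printing Implicit Defensive.

Import Order.TTheory GRing.Theory Num.Theory.
Import numFieldNormedType.Exports.

Local Open Scope classical_set_scope.
Local Open Scope ring_scope.

(** * Divided differences and the Christoffel-Darboux kernel *)

Definition divdiff (F : fieldType) (f : {poly F}) (x : F) : {poly F} :=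
  (f - f.[x]%:P) %/ ('X - x%:P).

Lemma divdiffK (F : fieldType) (f : {poly F}) (x : F) :
  divdiff f x * ('X - x%:P) = f - f.[x]%:P.
Proof. by rewrite divpK // dvdp_XsubCl /root !hornerE subrr. Qed.

Lemma size_divdiff (F : fieldType) (f : {poly F}) (x : F) (n : nat) :
  (size f <= n.+1)%N -> (size (divdiff f x) <= n)%N.
Proof.
move=> sf; rewrite size_divp ?polyXsubC_eq0 // size_XsubC /= leq_subLR add1n.
by rewrite (leq_trans (size_polyD _ _)) // size_polyN geq_max sf
  (leq_trans (size_polyC_leq1 _)).
Qed.

Lemma monic_divdiff (F : fieldType) (f : {poly F}) (x : F) :
  f \is monic -> (1 < size f)%N -> divdiff f x \is monic.
Proof.
move=> fmon sf; rewrite -(monicMr _ (monicXsubC x)) divdiffK.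
have sc : (size (- f.[x]%:P) < size f)%N.
  by rewrite size_polyN (leq_ltn_trans (size_polyC_leq1 _)).
by rewrite monicE lead_coefDl // -monicE.
Qed.

Section OrthogonalPolynomials.
Variables (F : fieldType) (L : {scalar {poly F}}) (p : nat -> {poly F}).
Hypothesis p_monic : forall n, p n \is monic.
Hypothesis size_p : forall n, size (p n) = n.+1.
Hypothesis p_orth : forall m n : nat, m != n -> L (p n * p m) = 0.

Lemma size_sub_lead (m : nat) (f : {poly F}) :
  (size f <= m.+1)%N -> (size (f - f`_m *: p m)%R <= m)%N.
Proof.
move=> sf; apply/leq_sizeP => j; rewrite leq_eqVlt => /predU1P[<-|mj].
  have /eqP := p_monic m; rewrite lead_coefE size_p /= => pm.
  by rewrite coefB coefZ pm mulr1 subrr.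
rewrite coefB coefZ [f`_j]nth_default ?(leq_trans sf) //.
by rewrite [(p m)`_j]nth_default ?size_p // mulr0 subrr.
Qed.

Lemma orthogonal_lower (n m : nat) (f : {poly F}) :
  (m <= n)%N -> (size f <= m)%N -> L (p n * f) = 0.
Proof.
elim: m f => [|m IH] f mn sf.
  by move: sf; rewrite leqn0 size_poly_eq0 => /eqP ->; rewrite mulr0 linear0.
rewrite -[f](subrK (f`_m *: p m)) mulrDr linearD /=.
rewrite IH ?size_sub_lead // 1?ltnW // add0r -scalerAr linearZ /=.
by rewrite p_orth ?mulr0 // ltn_eqF.
Qed.

(** The Christoffel-Darboux closed form of L (p_n ^ 2) times the sum over j <= n
    of p_j(x) p_j(y) / L (p_j ^ 2), for nonzero norms. Taking it as the definition
    avoids the three-term recurrence. *)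
Definition cd_kernel (n : nat) (x : F) : {poly F} :=
  (p n).[x] *: divdiff (p n.+1) x - (p n.+1).[x] *: divdiff (p n) x.

Lemma cd_kernelE (n : nat) (x : F) :
  cd_kernel n x * ('X - x%:P) = (p n).[x] *: p n.+1 - (p n.+1).[x] *: p n.
Proof.
rewrite mulrBl -!scalerAl !divdiffK !scalerBr -!mul_polyC -!polyCM.
by rewrite (mulrC (p n.+1).[x]) opprB addrA subrK.
Qed.

Lemma size_cd_kernel (n : nat) (x : F) : (size (cd_kernel n x) <= n.+1)%N.
Proof.
rewrite (leq_trans (size_polyD _ _)) // size_polyN geq_max.
by rewrite !(leq_trans (size_scale_leq _ _)) // size_divdiff ?size_p.
Qed.

(** With U and D the divided differences at x of p_n and p_{n+1}, both sides of
    (p_{n+1} - p_{n+1}(x)) U = (p_n - p_n(x)) D are the same product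
    D U (X - x). Apply L: p_{n+1} is orthogonal to U, and L (p_n D) = L (p_n ^ 2)
    since D is monic of degree n. *)
Lemma cd_kernel_mass (n : nat) (x : F) : L (cd_kernel n x) = L (p n * p n).
Proof.
set D := divdiff (p n.+1) x; set U := divdiff (p n) x.
have sU : (size U <= n)%N by rewrite size_divdiff ?size_p.
have sD : (size D <= n.+1)%N by rewrite size_divdiff ?size_p.
have Dmon : D \is monic by rewrite monic_divdiff ?p_monic ?size_p.
have Dn : D`_n = 1.
  move/monicP: Dmon; rewrite lead_coefE size_divp ?polyXsubC_eq0 //.
  rewrite size_XsubC size_polyDl ?size_p //.
  by rewrite size_polyN (leq_ltn_trans (size_polyC_leq1 _)).
have LQD : L (p n * D) = L (p n * p n).
  rewrite -[D in LHS](subrK (D`_n *: p n)) mulrDr linearD /=.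
  by rewrite (@orthogonal_lower n n) ?size_sub_lead // add0r Dn scale1r.
have : L ((p n.+1 - (p n.+1).[x]%:P) * U) = L ((p n - (p n).[x]%:P) * D).
  by rewrite -!divdiffK -/D -/U mulrAC [in RHS]mulrAC [D * U]mulrC.
rewrite !mulrBl !linearB /= (@orthogonal_lower n.+1 n) // LQD !mul_polyC.
by rewrite sub0r => E; rewrite [X in _ + X]E addrC subrK.
Qed.

(** Split f as f(x) + (X - x) g. The factor X - x turns the kernel into a
    combination of p_n and p_{n+1}, both orthogonal to g, so that only the
    constant f(x) contributes. *)
Lemma cd_kernel_reproduces (n : nat) (x : F) (f : {poly F}) :
  (size f <= n.+1)%N -> L (f * cd_kernel n x) = f.[x] * L (p n * p n).
Proof.
move=> sf; rewrite -[f in LHS](subrK f.[x]%:P) -divdiffK mulrDl linearD /=.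
rewrite mul_polyC linearZ /= cd_kernel_mass -mulrA [_ * cd_kernel _ _]mulrC.
rewrite cd_kernelE mulrBr linearB /= -!scalerAr !linearZ /=.
rewrite ![divdiff f x * _]mulrC.
have sg := size_divdiff x sf.
rewrite (@orthogonal_lower n.+1 n (divdiff f x)) //.
by rewrite (@orthogonal_lower n n (divdiff f x)) // !mulr0 subrr add0r.
Qed.

Lemma orthogonal_cd_kernel (n : nat) (x : F) :
  L (p n.+1 * cd_kernel n x) = 0.
Proof. by rewrite (@orthogonal_lower n.+1 n.+1) // size_cd_kernel. Qed.

(** With S the kernel, the left-hand side is L (p_{n+1}' S) + L (p_{n+1} S') by
    the product rule: the kernel reproduces the first term, and
    the second is 0 by orthogonality. *)
Lemma cd_kernel_deriv (n : nat) (x : F) :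
  L (p n.+1 * cd_kernel n x)^`() = L (p n * p n) * (p n.+1)^`().[x].
Proof.
rewrite derivM linearD /= cd_kernel_reproduces; last first.
  rewrite -ltnS (leq_trans (lt_size_deriv _)) ?size_p //.
  by rewrite -size_poly_eq0 size_p.
rewrite (@orthogonal_lower n.+1 n.+1 (cd_kernel n x)^`()) //.
  by rewrite addr0 mulrC.
have [->|S0] := eqVneq (cd_kernel n x) 0; first by rewrite linear0 size_poly0.
by rewrite (leq_trans (ltnW (lt_size_deriv S0))) // size_cd_kernel.
Qed.

End OrthogonalPolynomials.

(** * Integrals of derivatives over the real line *)

Section Analysis.
Variable R : realType.
Notation mu := (@lebesgue_measure R).

(** By the mean value theorem the difference between G and the primitive of g is
    constant. At the end points g is only asked to be integrable: one of them
    will be the singular point of the weight. *)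
Lemma Rintegral_open_FTC (G g : R -> R) (a b : R) : a < b ->
  mu.-integrable `[a, b] (EFin \o g) ->
  {within `[a, b], continuous G} ->
  (forall y, y \in `]a, b[ -> is_derive y 1 G (g y)) ->
  (forall y, y \in `]a, b[ -> {for y, continuous g}) ->
  \int[mu]_(y in `[a, b]) g y = G b - G a.
Proof.
move=> ab gi Gc dG gc.
pose I y := parameterized_integral mu a y g.
have dI y : y \in `]a, b[ -> is_derive y 1 (G \- I) (g y - g y).
  move=> yab; have /andP[ay yb] := yab.
  have [dI Iy] := continuous_FTC1_closed yb gi ay (gc _ yab).
  apply: is_deriveB; first exact: dG.
  by apply: DeriveDef; [exact: dI | rewrite -derive1E Iy].
have cI : {within `[a, b], continuous (G \- I)}.
  move=> y; apply: cvgB; first exact: Gc.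
  exact: (parameterized_integral_continuous (ltW ab) gi).
have [c _] := MVT ab dI cI.
rewrite subrr mul0r /= /I /parameterized_integral set_itv1 Rintegral_set1 subr0.
by move/eqP; rewrite addrAC subr_eq0 => /eqP.
Qed.

Lemma Rintegral_FTC_off_point (G g : R -> R) (k a b : R) : a < k < b ->
  mu.-integrable setT (EFin \o g) -> continuous G ->
  (forall y, y != k -> is_derive y 1 G (g y)) ->
  (forall y, y != k -> {for y, continuous g}) ->
  \int[mu]_(y in `[a, b]) g y = G b - G a.
Proof.
move=> /andP[ak kb] gi Gc dG gc.
have gS (i : interval R) : mu.-integrable [set` i] (EFin \o g).
  exact: integrableS gi.
have cW (c d : R) : {within `[c, d], continuous G}.
  exact: continuous_subspaceT.
have <- : \int[mu]_(y in `[a, k]) g y + \int[mu]_(y in `[k, b]) g y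
    = \int[mu]_(y in `[a, b]) g y.
  rewrite -(@Rintegral_itv_obnd_cbnd _ k) //.
  rewrite -(@Rintegral_itvB _ _ (BLeft a)) ?bnd_simp //;
    try exact: ltW.
  by rewrite addrC subrK.
have -> : \int[mu]_(y in `[k, b]) g y = G b - G k.
  apply: Rintegral_open_FTC => // y /andP[ky _].
    by apply: dG; rewrite gt_eqF.
  by apply: gc; rewrite gt_eqF.
have -> : \int[mu]_(y in `[a, k]) g y = G k - G a.
  apply: Rintegral_open_FTC => // y /andP[_ yk].
    by apply: dG; rewrite lt_eqF.
  by apply: gc; rewrite lt_eqF.
by rewrite addrC addrA subrK.
Qed.

(** Otherwise |f| would be bounded below by e on a set of infinite measure. *)
Lemma integrable_small_value d (T : measurableType d)
    (nu : {measure set T -> \bar R}) (f : T -> R) (D : set T) (e : R) :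
  measurable D -> nu D = +oo%E -> nu.-integrable D (EFin \o f) -> 0 < e ->
  exists2 y, D y & `|f y| < e.
Proof.
move=> mD Doo fi e0; apply: contrapT => nf.
have ef y : D y -> e <= `|f y|.
  by move=> Dy; rewrite leNgt; apply/negP => fy; apply: nf; exists y.
have /integrableP[mf] := fi; rewrite ltNge => /negP; apply.
have <- : (\int[nu]_(y in D) (cst e%:E y) = +oo)%E.
  by rewrite integral_cst // Doo gt0_muley // lte_fin.
apply: ge0_le_integral => //=.
- by move=> y _; rewrite lee_fin ltW.
- apply/measurable_EFinP/measurableT_comp => //; exact/measurable_EFinP.
Qed.

(** Since G is integrable there are points a_m tending to -oo and b_m tending to
    +oo at which G tends to 0. The integrals of g over [a_m, b_m] are
    G(b_m) - G(a_m), and they tend to the integral of g over the line by dominated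
    convergence. *)
Lemma integral_derive_eq0 (G g : R -> R) (k : R) :
  mu.-integrable setT (EFin \o G) -> mu.-integrable setT (EFin \o g) ->
  continuous G ->
  (forall y, y != k -> is_derive y 1 G (g y)) ->
  (forall y, y != k -> {for y, continuous g}) ->
  integralR g = 0.
Proof.
move=> Gi gi Gc dG gc.
have GiS (i : interval R) : mu.-integrable [set` i] (EFin \o G).
  exact: integrableS Gi.
have right_oo c : mu `]c, +oo[ = +oo%E.
  by rewrite lebesgue_measure_itv /= ?ltry ?ltNyr.
have left_oo c : mu `]-oo, c[ = +oo%E.
  by rewrite lebesgue_measure_itv /= ?ltry ?ltNyr.
(* The shift by k puts k inside every interval [a_m, b_m]. *)
have right_pt (m : nat) : {b | k + m.+1%:R < b & `|G b| < m.+1%:R^-1}.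
  apply/cid2; have m0 : 0 < m.+1%:R^-1 :> R by rewrite invr_gt0 ltr0n.
  have [|y] := integrable_small_value _ (right_oo (k + m.+1%:R)) (GiS _) m0.
    exact: measurable_itv.
  by rewrite /= in_itv /= andbT; exists y.
have left_pt (m : nat) : {a | a < k - m.+1%:R & `|G a| < m.+1%:R^-1}.
  apply/cid2; have m0 : 0 < m.+1%:R^-1 :> R by rewrite invr_gt0 ltr0n.
  have [|y] := integrable_small_value _ (left_oo (k - m.+1%:R)) (GiS _) m0.
    exact: measurable_itv.
  by rewrite /= in_itv /=; exists y.
pose a m := s2val (left_pt m); pose b m := s2val (right_pt m).
have ak m : a m < k - m.+1%:R by exact: s2valP (left_pt m).
have kb m : k + m.+1%:R < b m by exact: s2valP (right_pt m).
have Ga m : `|G (a m)| < m.+1%:R^-1 by exact: s2valP' (left_pt m).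
have Gb m : `|G (b m)| < m.+1%:R^-1 by exact: s2valP' (right_pt m).
pose f_ m := EFin \o (g \_ `[a m, b m]).
have mg : measurable_fun setT g by apply/measurable_EFinP; case/integrableP: gi.
have Gc0 (c : R^nat) : (forall m, `|G (c m)| < m.+1%:R^-1) ->
    G (c m) @[m --> \oo] --> 0.
  move=> Gcm; apply/cvgr0Pnorm_lt => e e0; near=> m.
  rewrite (lt_trans (Gcm m)) //.
  by near: m; exact: (near_infty_natSinv_lt (PosNum e0)).
have G0 : G (b m) - G (a m) @[m --> \oo] --> 0.
  by rewrite -[0 in X in _ --> X]subr0; apply: cvgB; exact: Gc0.
have If_ m : (\int[mu]_y f_ m y)%E = (G (b m) - G (a m))%:E.
  rewrite -(@Rintegral_FTC_off_point G g k) //; last first.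
    have m0 : 0 < m.+1%:R :> R by rewrite ltr0n.
    by have := ak m; have := kb m; lra.
  rewrite /f_ -restrict_EFin -integral_mkcond /Rintegral fineK //.
  by apply: integrable_fin_num => //; exact: integrableS gi.
have : (\int[mu]_y f_ m y)%E @[m --> \oo] --> (\int[mu]_y (g y)%:E)%E.
  have [||||| _ _ //] := @dominated_convergence _ _ R mu setT measurableT
    f_ (EFin \o g) (EFin \o (fun y => `|g y|)).
  - move=> m; apply/measurable_EFinP/measurable_restrict => //.
    exact: measurable_funS mg.
  - exact/measurable_EFinP.
  - apply: aeW => y _; apply: cvg_near_cst; near=> m.
    rewrite /f_ /= patchE mem_set //= in_itv /=.
    have : `|y - k| < m%:R by near: m; exact: nbhs_infty_gtr.
    have := ak m; have := kb m; rewrite -natr1 ltr_norml.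
    by move=> ? ? /andP[? ?]; apply/andP; split; lra.
  - exact: integrable_norm.
  - apply: aeW => y m _; rewrite /f_ /= patchE; case: ifP => _ //=.
    by rewrite (_ : point = 0) // normr0 lee_fin.
under eq_cvg do rewrite If_.
move=> Ig.
have G0E : (G (b m) - G (a m))%:E @[m --> \oo] --> 0%E.
  by apply: cvg_EFin => //; exact: nearW.
rewrite /integralR /Rintegral.
by have -> := cvg_unique _ Ig G0E.
Unshelve. all: by end_near. Qed.

End Analysis.

(** * The weight and its logarithmic derivative *)

Section Weight.
Variables (R : realType) (k gamma t : R) (v : R -> R -> R).
Hypothesis gamma_ge1 : 1 <= gamma.
Notation w := (fun x => weight k gamma v x t).

Lemma weight_at_k : weight k gamma v k t = 0.
Proof.
by rewrite /weight subrr normr0 powR0 ?mul0r // gt_eqF // (lt_le_trans ltr01).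
Qed.

(** The two signs of y - k give the same formula because the logarithmic
    derivative of the distance to k is 1 / (y - k) on both sides. *)
Lemma is_derive_dist_powR (y : R) : y != k ->
  is_derive y 1 (fun z => `|z - k| `^ gamma)
    (gamma / (y - k) * `|y - k| `^ gamma).
Proof.
have powB1 (c : R) : 0 < c -> gamma * c `^ (gamma - 1) = gamma / c * c `^ gamma.
  move=> c0; rewrite powRB; last by rewrite (gt_eqF c0) implybT.
  by rewrite powRr1 ?ltW // mulrA mulrAC.
rewrite neq_lt => /orP[yk|ky].
- have d : is_derive y 1 ((@powR R)^~ gamma \o (fun z => k - z))
      (gamma * (k - y) `^ (gamma - 1) * (0 - 1)).
    by apply: is_derive1_comp; apply: is_derive1_powR; rewrite subr_gt0.
  have nearE : \forall z \near y, ((@powR R)^~ gamma \o (fun z => k - z)) z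
      = `|z - k| `^ gamma.
    near=> z; rewrite /= ltr0_norm ?opprB // subr_lt0.
    by near: z; exact: lt_nbhsl.
  apply: is_derive_eq (near_eq_is_derive nearE d) _.
  rewrite ltr0_norm ?subr_lt0 // opprB powB1 ?subr_gt0 //.
  by rewrite sub0r mulrN1 -[y - k]opprB invrN mulrN mulNr.
- have d : is_derive y 1 ((@powR R)^~ gamma \o (fun z => z - k))
      (gamma * (y - k) `^ (gamma - 1) * (1 - 0)).
    by apply: is_derive1_comp; apply: is_derive1_powR; rewrite subr_gt0.
  have nearE : \forall z \near y, ((@powR R)^~ gamma \o (fun z => z - k)) z
      = `|z - k| `^ gamma.
    near=> z; rewrite /= gtr0_norm // subr_gt0.
    by near: z; exact: lt_nbhsr.
  apply: is_derive_eq (near_eq_is_derive nearE d) _.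
  by rewrite gtr0_norm ?subr_gt0 // subr0 mulr1 powB1 ?subr_gt0.
Unshelve. all: by end_near. Qed.

Lemma continuous_dist_powR : continuous (fun z : R => `|z - k| `^ gamma).
Proof.
move=> y; have [->|yk] := eqVneq y k; last first.
  by have [d _] := is_derive_dist_powR yk;
    exact/differentiable_continuous/derivable1_diffP.
rewrite /continuous_at subrr normr0 powR0 ?gt_eqF ?(lt_le_trans ltr01) //.
apply: (@squeeze_cvgr _ _ _ _ (cst 0) (fun z => `|z - k|)).
- (* For gamma >= 1, the power is at most the distance itself within distance 1. *)
  near=> z; rewrite powR_ge0 /=.
  have [->|zk] := eqVneq z k.
    by rewrite subrr normr0 powR0 // gt_eqF // (lt_le_trans ltr01).
  apply: ge1r_powR => //; rewrite normr_gt0 subr_eq0 zk /= distrC.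
  by near: z; exists 1 => //= z; exact: ltW.
- exact: cvg_cst.
- have : `|z - k| @[z --> k] --> `|k - k|.
    by apply: cvg_norm; apply: cvgB; [exact: cvg_id | exact: cvg_cst].
  by rewrite subrr normr0.
Unshelve. all: by end_near. Qed.

Hypothesis v_derivable : forall x : R, derivable (v ^~ t) x 1.

Lemma continuous_weight : continuous w.
Proof.
move=> y; apply: cvgM; first exact: continuous_dist_powR.
apply: (@continuous_comp _ _ _ (fun z => - v z t) expR);
  last exact: continuous_expR.
by apply: cvgN; exact/differentiable_continuous/derivable1_diffP.
Qed.

Lemma is_derive_weight (y : R) : y != k ->
  is_derive y 1 w ((gamma / (y - k) - dv v y t) * w y).
Proof.
move=> yk.
have dE : is_derive y 1 (expR \o (fun z => - v z t))
    (expR (- v y t) * - dv v y t).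
  apply: is_derive1_comp; apply: is_deriveN.
  by apply: DeriveDef => //; rewrite /dv derive1E.
apply: is_derive_eq (is_deriveM (is_derive_dist_powR yk) dE) _.
by rewrite /weight /= /GRing.scale /=; ring.
Qed.

End Weight.

(** * Moments and integration by parts *)

Lemma integrableR_comb (R : realType) (a b : R) (f g : R -> R) :
  integrableR f -> integrableR g -> integrableR (fun y => a * f y + b * g y).
Proof.
move=> fi gi; exact: (integrableD measurableT (integrableZl measurableT a fi)
  (integrableZl measurableT b gi)).
Qed.

Lemma integralR_comb (R : realType) (a b : R) (f g : R -> R) :
  integrableR f -> integrableR g ->
  integralR (fun y => a * f y + b * g y) = a * integralR f + b * integralR g.
Proof.
move=> fi gi.
have ZI (c : R) (u : R -> R) : integrableR u -> integrableR (fun y => c * u y).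
  by move=> ui; exact: (integrableZl measurableT c ui).
rewrite /integralR RintegralD //; [|exact: ZI..].
by rewrite !RintegralZl.
Qed.

Section Moments.
Variables (R : realType) (k gamma t : R) (v : R -> R -> R).
Notation w := (fun x => weight k gamma v x t).
Hypothesis moments_exist : forall m : nat,
  integrableR (fun x : R => x ^+ m * w x).

Lemma integrable_poly_weight (p : {poly R}) :
  integrableR (fun x => p.[x] * w x).
Proof.
(* The extra power of x lets the Horner recursion p X + c go through. *)
suff H m : integrableR (fun x => x ^+ m * p.[x] * w x).
  by have := H 0; congr integrableR; apply/funext => x; rewrite expr0 mul1r.
elim/poly_ind: p m => [|p c IH] m.
  have := integrableR_comb 0 0 (moments_exist 0) (moments_exist 0).
  by congr integrableR; apply/funext => x; rewrite horner0; ring.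
have := integrableR_comb 1 c (IH m.+1) (moments_exist m).
congr integrableR; apply/funext => x; rewrite hornerMXaddC exprS; ring.
Qed.

Definition moment (p : {poly R}) : R := integralR (fun x => p.[x] * w x).

Lemma moment_is_scalar : scalar moment.
Proof.
move=> a p q.
have := integralR_comb a 1 (integrable_poly_weight p)
  (integrable_poly_weight q).
rewrite mul1r => <-.
by congr integralR; apply/funext => x; rewrite hornerD hornerZ; ring.
Qed.

Definition moment_functional : {scalar {poly R}} :=
  HB.pack moment (GRing.isLinear.Build R {poly R} R *%R moment moment_is_scalar).

Hypothesis gamma_ge1 : 1 <= gamma.
Hypothesis v_derivable : forall x : R, derivable (v ^~ t) x 1.
Hypothesis dv_continuous : continuous (fun x : R => dv v x t).

(** Integration by parts against w: the derivative of p w vanishes in the mean,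
    and the logarithmic derivative of w is gamma / (y - k) - v'(y). *)
Lemma moment_deriv (p : {poly R}) :
  integrableR (fun y => p.[y] * dv v y t * w y) ->
  integrableR (fun y => p.[y] / (y - k) * w y) ->
  moment p^`() = integralR (fun y => p.[y] * dv v y t * w y)
    - gamma * integralR (fun y => p.[y] / (y - k) * w y).
Proof.
move=> pdv pk.
pose g y := 1 * (p^`().[y] * w y) + 1 * (gamma * (p.[y] / (y - k) * w y)
  + (-1) * (p.[y] * dv v y t * w y)).
have pw := integrable_poly_weight p; have dpw := integrable_poly_weight p^`().
have rest := integrableR_comb gamma (-1) pk pdv.
have : integralR g = 0.
  apply: (integral_derive_eq0 (G := fun y => p.[y] * w y) (k := k)) => //.
  - exact: integrableR_comb.
  - move=> y; apply: cvgM; first exact: continuous_horner.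
    exact: continuous_weight.
  - move=> y yk.
    have dw := is_derive_weight gamma v_derivable yk.
    have dp : is_derive y 1 (horner p) p^`().[y] := is_derive_poly p y.
    have dpw' := is_deriveM dp dw.
    apply: is_derive_eq dpw' _.
    by rewrite /g /GRing.scale /=; ring.
  - move=> y yk; have ch (q : {poly R}) : q.[z] @[z --> y] --> q.[y].
      exact: continuous_horner.
    have cw : w z @[z --> y] --> w y by exact: continuous_weight.
    have cV : (z - k)^-1 @[z --> y] --> (y - k)^-1.
      apply: cvgV; rewrite ?subr_eq0 //.
      by apply: cvgB; [exact: cvg_id | exact: cvg_cst].
    have cdv : dv v z t @[z --> y] --> dv v y t by exact: dv_continuous.
    apply: cvgD; (apply: cvgM; first exact: cvg_cst).
      by apply: cvgM.
    apply: cvgD; (apply: cvgM; first exact: cvg_cst).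
      by apply: cvgM => //; apply: cvgM.
    by apply: cvgM => //; apply: cvgM.
rewrite /g integralR_comb // integralR_comb // => /eqP.
by rewrite mul1r mul1r mulN1r addr_eq0 opprB => /eqP.
Qed.

End Moments.

(** * The differential-difference equation *)

(** The convention K(x, x) = 0 is harmless, since both sides vanish there. *)
Lemma sub_mul_kernelK (R : realType) (v : R -> R -> R) (t x y : R) :
  (y - x) * kernelK v t x y = dv v y t - dv v x t.
Proof.
rewrite /kernelK; have [->|xy] := eqVneq x y; first by rewrite !subrr mul0r.
by rewrite -opprB mulNr mulrC divfK ?subr_eq0 // opprB.
Qed.

Theorem theorem2p1 (R : realType) (t k gamma : R) (v : R -> R -> R)
    (P : nat -> R -> {poly R}) (h : nat -> R -> R)
    (v_derivable : forall x : R, derivable (v ^~ t) x 1)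
    (dv_continuous : continuous (fun x : R => dv v x t))
    (moments_exist : forall m : nat,
      integrableR (fun x : R => x ^+ m * weight k gamma v x t))
    (P_orthogonal :
      monic_orthogonal (fun x : R => weight k gamma v x t)
        (fun n => P n t) (fun n => h n t))
    (gamma_ge1 : 1 <= gamma)
    (n : nat) (n_ge1 : (1 <= n)%N)
    (A_converges : forall x : R, integrableR (A_integrand k gamma v P n t x))
    (B_converges : forall x : R, integrableR (B_integrand k gamma v P n t x))
    (a_converges : integrableR (a_integrand k gamma v P n t))
    (b_converges : integrableR (b_integrand k gamma v P n t))
    (x : R) :
  (x - k) * derive1 (fun z : R => (P n t).[z]) x =
    - B_coef k gamma v P h n t x * (P n t).[x]
    + A_coef k gamma v P h n t x * (P n.-1 t).[x].
Proof.
have [Pms Porth h_gt0] := P_orthogonal.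
case: n n_ge1 A_converges B_converges a_converges b_converges
  => // m _ Ai Bi ai bi.
pose p j := P j t; pose S := cd_kernel p m x.
pose w y := weight k gamma v y t.
pose L := moment_functional moments_exist.
have LE q : L q = integralR (fun y => q.[y] * w y) by [].
have p_monic j : p j \is monic by case: (Pms j).
have size_p j : size (p j) = j.+1 by case: (Pms j).
have Lpp i j : L (p j * p i) = h j t * (i == j)%:R.
  rewrite LE -Porth; congr integralR; apply/funext => y.
  by rewrite hornerM.
have p_orth i j : i != j -> L (p j * p i) = 0.
  by move=> /negPf ij; rewrite Lpp ij mulr0.
have Lmm : L (p m * p m) = h m t by rewrite Lpp eqxx mulr1.
have h0 : h m t != 0 by rewrite gt_eqF.
have SE y : S.[y] * (y - x)
    = (p m).[x] * (p m.+1).[y] - (p m.+1).[x] * (p m).[y].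
  have := congr1 (horner^~ y) (cd_kernelE p m x).
  by rewrite hornerM hornerXsubC !hornerE.
have LpS : L (p m.+1 * S) = 0 by exact: orthogonal_cd_kernel.
have LdpS : L (p m.+1 * S)^`() = h m t * (p m.+1)^`().[x].
  by rewrite -Lmm; exact: cd_kernel_deriv.
have pSi := integrable_poly_weight moments_exist (p m.+1 * S).
set Ia := integralR (a_integrand k gamma v P m.+1 t).
set Ib := integralR (b_integrand k gamma v P m.+1 t).
set IA := integralR (A_integrand k gamma v P m.+1 t x).
set IB := integralR (B_integrand k gamma v P m.+1 t x).
have abE y : (p m).[x] * a_integrand k gamma v P m.+1 t y
    + (- (p m.+1).[x]) * b_integrand k gamma v P m.+1 t y
    = (p m.+1).[y] * S.[y] * ((y - x) / (y - k)) * w y.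
  transitivity ((p m.+1).[y] * (S.[y] * (y - x)) / (y - k) * w y); last by ring.
  by rewrite SE /a_integrand /b_integrand /= -/(p _) -/(p _) -/(w y); ring.
have ABE y : (p m).[x] * A_integrand k gamma v P m.+1 t x y
    + (- (p m.+1).[x]) * B_integrand k gamma v P m.+1 t x y
    = (p m.+1 * S).[y] * (dv v y t - dv v x t) * w y.
  rewrite -sub_mul_kernelK hornerM.
  transitivity ((p m.+1).[y] * (S.[y] * (y - x)) * kernelK v t x y * w y);
    last by ring.
  by rewrite SE /A_integrand /B_integrand /= -/(p _) -/(p _) -/(w y); ring.
have abI := integralR_comb (p m).[x] (- (p m.+1).[x]) ai bi.
have abi := integrableR_comb (p m).[x] (- (p m.+1).[x]) ai bi.
have ABI := integralR_comb (p m).[x] (- (p m.+1).[x]) (Ai x) (Bi x).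
have ABi := integrableR_comb (p m).[x] (- (p m.+1).[x]) (Ai x) (Bi x).
have -> : derive1 (fun z => (P m.+1 t).[z]) x = ((p m.+1)^`()).[x].
  by rewrite derivE.
rewrite /A_coef /B_coef /a_coef /b_coef /= -/Ia -/Ib -/IA -/IB -/(p _) -/(p _).
suff : (x - k) * (h m t * (p m.+1)^`().[x]) =
    (x - k) * ((p m).[x] * IA - (p m.+1).[x] * IB)
    + gamma * ((p m).[x] * Ia - (p m.+1).[x] * Ib).
  by move=> E; apply: (mulfI h0); rewrite mulrCA E; field.
move: abI ABI abi ABi; rewrite (funext abE) (funext ABE).
rewrite -/Ia -/Ib -/IA -/IB => abI ABI abi ABi; rewrite -!mulNr -abI -ABI.
have [xk|xk] := eqVneq x k.
  have xk0 : x - k = 0 by rewrite xk subrr.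
  rewrite xk0 !mul0r add0r -[LHS](mulr0 gamma) -LpS LE.
  (* (y - k) / (y - k) = 1 except at y = k, where the weight vanishes. *)
  congr (_ * integralR _); apply/funext => y; rewrite hornerM xk.
  have [->|yk] := eqVneq y k; first by rewrite /w weight_at_k // !mulr0.
  by rewrite divff ?subr_eq0 // mulr1.
have xk0 : x - k != 0 by rewrite subr_eq0.
(* The two integrands produced by integration by parts, each a combination of
   moments and of a function known to be integrable. *)
pose Dv y := (p m.+1 * S).[y] * dv v y t * w y.
pose J y := (p m.+1 * S).[y] / (y - k) * w y.
have JE y : J y = (x - k)^-1 * ((p m.+1 * S).[y] * w y)
   + (- (x - k)^-1) * ((p m.+1).[y] * S.[y] * ((y - x) / (y - k)) * w y).
  rewrite /J hornerM; have [->|yk] := eqVneq y k.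
    by rewrite /w weight_at_k // !mulr0 addr0.
  by field; rewrite xk0 subr_eq0 yk.
have DvE y : Dv y = 1 * ((p m.+1 * S).[y] * (dv v y t - dv v x t) * w y)
    + dv v x t * ((p m.+1 * S).[y] * w y).
  by rewrite /Dv; ring.
have Ji : integrableR J by rewrite (funext JE); exact: integrableR_comb.
have Dvi : integrableR Dv by rewrite (funext DvE); exact: integrableR_comb.
have := moment_deriv moments_exist gamma_ge1 v_derivable dv_continuous Dvi Ji.
rewrite -/J -/Dv [in X in _ = X - _](funext DvE) [in X in _ = _ - X](funext JE).
rewrite !integralR_comb // -!/(w _) -LE LpS !mulr0 mul1r addr0 add0r.
by rewrite -[moment _ _ _ _ _]/(L _) LdpS => ->; field.
Qed.
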